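(* Let $1\le p<\infty$. Let $A=(a_{nk})$ be an infinite real matrix with $A\in(\ell_1(\widehat F),\ell_p)$, and let $\bar a_{nk}=\sum_{j=k}^{\infty}\frac{f_{j+1}^{2}}{f_kf_{k+1}}a_{nj}$ for $n,k\in\mathbb N$. Then $$\|L_A\|_\chi=\lim_{m\to\infty}\left(\sup_k\Big(\sum_{n=m}^{\infty}|\bar a_{nk}|^p\Big)^{1/p}\right),$$ and $L_A$ is compact if and only if $$\lim_{m\to\infty}\left(\sup_k\Big(\sum_{n=m}^{\infty}|\bar a_{nk}|^p\Big)^{1/p}\right)=0.$$
   Context: $\mathbb N=\{0,1,2,\dots\}$; sums $\sum_k$ and suprema $\sup_k$ run over $k\in\mathbb N$. $\omega$ is the space of all real sequences $x=(x_k)_{k\in\mathbb N}$; $\ell_p$ ($1\le p<\infty$) is the usual space of real $p$-summable sequences with its usual norm. Fibonacci numbers: $f_0=f_1=1$, $f_n=f_{n-1}+f_{n-2}$ for $n\ge2$. For $x\in\omega$ the sequence $y=\widehat F x$ is given by $y_0=\frac{f_0}{f_1}x_0=x_0$ and $y_n=\frac{f_n}{f_{n+1}}x_n-\frac{f_{n+1}}{f_n}x_{n-1}$ for $n\ge1$. $\ell_1(\widehat F)=\{x\in\omega:\widehat F x\in\ell_1\}$, a Banach space with norm $\|x\|_{\ell_1(\widehat F)}=\|\widehat Fx\|_{\ell_1}$. For sequence spaces $X,Y$, $(X,Y)$ is the set of infinite real matrices $A=(a_{nk})_{n,k\in\mathbb N}$ such that for every $x\in X$ the series $A_n(x)=\sum_k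 a_{nk}x_k$ converges for every $n$ and $Ax=(A_n(x))_n\in Y$. For $A\in(X,Y)$, $L_A:X\to Y$ is the linear operator $L_A(x)=Ax$ (bounded for the spaces considered here). For $A\in(\ell_1(\widehat F),\ell_p)$ the series defining $\bar a_{nk}$ converge for all $n,k$. Hausdorff measure of noncompactness: for a bounded subset $Q$ of a metric space $Y$, $\chi(Q)$ is the infimum of all $\varepsilon>0$ such that $Q$ is covered by finitely many balls $B(x_i,r_i)$ with centres $x_i\in Y$ and radii $r_i<\varepsilon$. For a bounded linear operator $L:X\to Y$ between Banach spaces, $\|L\|_\chi=\chi(L(S_X))$, where $S_X$ is the unit sphere of $X$ and $\chi$ is taken in $Y$. A linear operator $L:X\to Y$ defined on all of $X$ is compact if $L(Q)$ is totally bounded for every bounded $Q\subset X$. *)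

(* Defs.v *)
From HB Require Import structures.
From mathcomp Require Import all_boot all_order all_algebra.
From mathcomp Require Import all_classical all_reals all_analysis.

Set Implicit Arguments.
Unset Strict Implicit.
Unset Printing Implicit Defensive.

Import Order.TTheory GRing.Theory Num.Theory.
Import numFieldNormedType.Exports.

Local Open Scope classical_set_scope.
Local Open Scope ring_scope.

(* Indexed so that f_0 = f_1 = 1. *)
Fixpoint fib (n : nat) : nat :=
  match n with
  | 0%N => 1%N
  | m.+1 => match m with
            | 0%N => 1%N
            | l.+1 => (fib m + fib l)%N
            end
  end.

(* A space of real sequences with its norm. [snorm] is a total function, but
   it is only meaningful on [carrier]. *)
Record seqspace (R : realType) := SeqSpace {
  carrier :> set (nat -> R) ;
  snorm : (nat -> R) -> R
}.

(* With the counting measure on nat, Lnorm is (\sum_k |x_k|^p)^(1/p), see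
   Lnorm_counting; every function on nat is measurable. *)
Definition lp (R : realType) (p : R) : seqspace R :=
  SeqSpace [set x | finite_norm (@counting nat R) p%:E x]
           (fun x => fine (Lnorm (@counting nat R) p%:E (EFin \o x))).

Definition Fhat (R : realType) (x : nat -> R) : nat -> R := fun n =>
  match n with
  | 0%N => (fib 0)%:R / (fib 1)%:R * x 0%N
  | m.+1 => (fib n)%:R / (fib n.+1)%:R * x n
            - (fib n.+1)%:R / (fib n)%:R * x m
  end.

Definition l1Fhat (R : realType) : seqspace R :=
  SeqSpace [set x | carrier (lp 1) (Fhat x)] (fun x => snorm (lp 1) (Fhat x)).

Definition mxop (R : realType) (A : nat -> nat -> R) (x : nat -> R) : nat -> R :=
  fun n => limn (series (fun k => A n k * x k)).

Definition mxclass (R : realType) (X Y : set (nat -> R)) :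
    set (nat -> nat -> R) :=
  [set A | forall x, X x ->
     (forall n, cvgn (series (fun k => A n k * x k))) /\ Y (mxop A x)].

Definition abar (R : realType) (A : nat -> nat -> R) (n k : nat) : R :=
  limn (fun N : nat => \sum_(k <= j < N)
    (fib j.+1)%:R ^+ 2 / ((fib k)%:R * (fib k.+1)%:R) * A n j).

Section MetricSpace.
(* The metric space is the subset Y of T with the distance d. *)
Context (R : realType) (T : Type) (Y : set T) (d : T -> T -> R).

Definition mball (c : T) (r : R) : set T := [set y | Y y /\ d c y < r].

(* Centres lie in Y, not necessarily in Q. *)
Definition finite_ball_cover (Q : set T) (e : R) : Prop :=
  exists (n : nat) (c : 'I_n -> T) (r : 'I_n -> R),
    (forall i, Y (c i) /\ 0 < r i < e) /\
    Q `<=` \bigcup_i mball (c i) (r i).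

(* Extended-real valued: +oo when there is no finite cover at all, hence
   finite on bounded subsets Q of Y. *)
Definition hausdorff_mnc (Q : set T) : \bar R :=
  ereal_inf [set e%:E | e in [set e | 0 < e /\ finite_ball_cover Q e]].

Definition totally_bounded_in (Q : set T) : Prop :=
  forall e : R, 0 < e -> exists (n : nat) (c : 'I_n -> T),
    (forall i, Y (c i)) /\ Q `<=` \bigcup_i mball (c i) e.

End MetricSpace.

Definition sdist (R : realType) (X : seqspace R) (x y : nat -> R) : R :=
  snorm X (fun k => x k - y k).

Definition unit_sphere (R : realType) (X : seqspace R) : set (nat -> R) :=
  [set x | carrier X x /\ snorm X x = 1].

Definition bounded_subset (R : realType) (X : seqspace R)
    (Q : set (nat -> R)) : Prop :=
  Q `<=` X /\ exists M : R, forall x, Q x -> snorm X x <= M.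

Definition op_mnc (R : realType) (X Y : seqspace R)
    (L : (nat -> R) -> (nat -> R)) : \bar R :=
  hausdorff_mnc Y (sdist Y) (L @` unit_sphere X).

Definition compact_op (R : realType) (X Y : seqspace R)
    (L : (nat -> R) -> (nat -> R)) : Prop :=
  forall Q, bounded_subset X Q ->
    totally_bounded_in Y (sdist Y) (L @` Q).

(* Main.v *)
(** Write [y = Fhat x].  Summation by parts with [wsum a N = \sum_(j < N) f_{j+1}^2 a_j]
    gives [\sum_(k < N) a_k x_k = \sum_(k < N) y_k (wsum a N - wsum a k) / (f_k f_{k+1})].
    Convergence of the series for the single sequence with [y = e_0] already says that
    [wsum (A n)] converges, so each row of [abar A] is bounded and [L_A] becomes the matrix
    [abar A] acting on [y] in l_1; no uniform boundedness principle is needed.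

    Let [u m] be the supremum over [k] of the l_p norm of the [k]-th column of [abar A]
    restricted to [n >= m].  By Minkowski, on the ball of radius [M] the tail of [L_A x]
    has norm at most [M * u m], while its first [m] coordinates stay in a box, which has a
    finite net: this bounds the measure of noncompactness from above.  Conversely a finite
    cover by balls of radius [e] covers the columns of [abar A], which are the values of
    [L_A] at the unit vectors [Fhat_basis k]; since the tails of the finitely many centres
    vanish, [lim u <= e]. *)
Require Import Defs.
From HB Require Import structures.
From mathcomp Require Import all_boot all_order all_algebra.
From mathcomp Require Import all_classical all_reals all_analysis.
From mathcomp Require Import ring lra.
Import Order.TTheory GRing.Theory Num.Theory.
Import numFieldNormedType.Exports.
Local Open Scope classical_set_scope.
Local Open Scope ring_scope.

(** * Tails of l_p norms *)

Definition tail_norm {R : realType} (p : R) (m : nat) (z : nat -> R) : \bar R :=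
  ((\sum_(m <= n <oo) (`|z n| `^ p)%:E) `^ p^-1)%E.

Lemma tail_norm_ge0 {R : realType} (p : R) m z : (0 <= tail_norm p m z)%E.
Proof. exact: poweR_ge0. Qed.

(** Bridge to [Lnorm]: it transfers Minkowski's inequality to tails and, at [m = 0], gives the norm
    of [lp]. *)
Lemma tail_normE {R : realType} (p : R) m (z : nat -> R) : 0 < p ->
  tail_norm p m z = Lnorm (@counting nat R) p%:E
    (EFin \o (fun n => if (n < m)%N then 0 else z n)).
Proof.
move=> p0; rewrite Lnorm_counting// /tail_norm; congr (_ `^ _)%E.
rewrite eseries_cond eseries_mkcond; apply: eq_eseriesr => n _.
by rewrite /= ltnNge; case: (m <= n)%N => //=; rewrite normr0 powR0// gt_eqF.
Qed.

(** The terms are nonnegative, so bounding the series amounts to bounding its partial sums.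
    Estimates and limits then take place in finite real sums. *)
Lemma tail_norm_leP {R : realType} {p K : R} {m} {z : nat -> R} : 0 < p -> 0 <= K ->
  (tail_norm p m z <= K%:E)%E <->
  (forall P, \sum_(m <= n < P) `|z n| `^ p <= K `^ p).
Proof.
move=> p0 K0; set S := (\sum_(m <= n <oo) (`|z n| `^ p)%:E)%E.
have S0 : (0 <= S)%E by apply: nneseries_ge0 => n _ _; rewrite lee_fin powR_ge0.
have E1 : (S <= (K `^ p)%:E)%E <-> forall P, \sum_(m <= n < P) `|z n| `^ p <= K `^ p.
  split=> [H P|H].
    rewrite -lee_fin -sumEFin; apply: le_trans H.
    by apply: nneseries_lim_ge => n _ _; rewrite lee_fin powR_ge0.
  apply: lime_le; first by apply: is_cvg_nneseries => n _ _; rewrite lee_fin powR_ge0.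
  by near=> n; rewrite sumEFin lee_fin.
rewrite -E1 /tail_norm -/S; split=> H.
  have := @gt0_ler_poweR R _ (ltW p0) _ _ _ _ H.
  rewrite -poweRrM mulVf ?gt_eqF// poweRe1// poweR_EFin; apply.
  by rewrite in_itv/= poweR_ge0 leey.
  by rewrite in_itv/= lee_fin K0 leey.
have -> : K = (K `^ p) `^ p^-1 by rewrite -powRrM mulfV ?gt_eqF// powRr1.
rewrite -poweR_EFin; apply: (@gt0_ler_poweR R) => //; first by rewrite invr_ge0 ltW.
  by rewrite in_itv/= S0 leey.
by rewrite in_itv/= lee_fin powR_ge0 leey.
Unshelve. all: by end_near. Qed.

Lemma tail_normD {R : realType} (p : R) m (z w : nat -> R) : 1 <= p ->
  (tail_norm p m (fun n => (z n + w n)%R) <= tail_norm p m z + tail_norm p m w)%E.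
Proof.
move=> p1; have p0 : 0 < p by exact: lt_le_trans p1.
rewrite !tail_normE//; apply: le_trans (minkowski_EFin _ _ _ p1) => //.
by rewrite le_eqVlt; apply/orP; left; apply/eqP; congr Lnorm; apply/funext => n /=;
  case: ifP => //; rewrite addr0.
Qed.

Lemma tail_norm_scale_le {R : realType} {p : R} (a : R) {K : R} {m} {z : nat -> R} : 0 < p -> 0 <= K ->
  (tail_norm p m z <= K%:E)%E ->
  (tail_norm p m (fun n => (a * z n)%R) <= (`|a| * K)%:E)%E.
Proof.
move=> p0 K0 /(tail_norm_leP p0 K0) H.
apply/tail_norm_leP => //; first exact: mulr_ge0.
move=> P; rewrite powRM//; under eq_bigr do rewrite normrM powRM//.
by rewrite -mulr_sumr ler_wpM2l// powR_ge0.
Qed.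

Lemma tail_normN {R : realType} (p : R) m (z : nat -> R) :
  tail_norm p m (fun n => - z n) = tail_norm p m z.
Proof. by rewrite /tail_norm; under eq_eseriesr do rewrite normrN. Qed.

Lemma tail_norm_nonincreasing {R : realType} {p : R} (z : nat -> R) {m m'} : 0 < p ->
  (m <= m')%N -> (tail_norm p m' z <= tail_norm p m z)%E.
Proof.
move=> p0 mm'.
have [y|] := eqVneq (tail_norm p m z) +oo%E; first by rewrite y leey.
rewrite -ltey -ge0_fin_numE ?tail_norm_ge0// => fn.
have K0 : 0 <= fine (tail_norm p m z) by rewrite fine_ge0// tail_norm_ge0.
rewrite -(fineK fn); apply/tail_norm_leP => // P.
have /(tail_norm_leP p0 K0) H : (tail_norm p m z <= (fine (tail_norm p m z))%:E)%E.
  by rewrite fineK.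
have [m'P|Pm'] := leqP m' P; last by rewrite big_geq ?powR_ge0// ltnW.
apply: le_trans (H P); rewrite (big_cat_nat mm' m'P)/= lerDr.
by apply: sumr_ge0 => n _; exact: powR_ge0.
Qed.

Lemma tail_norm_small {R : realType} {p e : R} {z : nat -> R} : 0 < p -> 0 < e ->
  (tail_norm p 0 z < +oo)%E -> \forall m \near \oo, (tail_norm p m z <= e%:E)%E.
Proof.
move=> p0 e0 zoo.
have S0 m : (0 <= \sum_(m <= n <oo) (`|z n| `^ p)%:E)%E.
  by apply: nneseries_ge0 => n _ _; rewrite lee_fin powR_ge0.
have Soo : (\sum_(0 <= n <oo) (`|z n| `^ p)%:E < +oo)%E.
  move: zoo; rewrite !ltey; apply: contraNneq; rewrite /tail_norm => ->.
  by rewrite poweRyr// invr_neq0// gt_eqF.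
have /fine_cvgP[_ /cvgr_lt/(_ (e `^ p))] := @nneseries_tail_cvg R _ xpredT Soo (fun k _ => powR_ge0 _ _).
move=> /(_ (powR_gt0 _ e0)); apply: filterS => m /= H.
apply/tail_norm_leP => //; first exact: ltW.
move=> P; apply: le_trans (ltW H).
rewrite -lee_fin fineK; last first.
  rewrite ge0_fin_numE//; apply: le_lt_trans Soo.
  rewrite [leRHS](nneseries_split 0 m); last by move=> n _; rewrite lee_fin powR_ge0.
  by rewrite add0n leeDr// sume_ge0// => n _; rewrite lee_fin powR_ge0.
rewrite -sumEFin; apply: nneseries_lim_ge => n _ _; rewrite lee_fin powR_ge0//.
Qed.

Lemma lp_carrierE {R : realType} {p : R} (x : nat -> R) : 0 < p ->
  carrier (lp p) x <-> (tail_norm p 0 x < +oo)%E.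
Proof.
by move=> p0; rewrite tail_normE//.
Qed.

Lemma lp_snormE {R : realType} {p : R} (x : nat -> R) : 0 < p ->
  snorm (lp p) x = fine (tail_norm p 0 x).
Proof. by move=> p0; rewrite tail_normE. Qed.

(** * Fibonacci numbers, the inverse of [Fhat] and summation by parts *)

Local Arguments fib : simpl never.

Lemma fib_gt0 n : (0 < fib n)%N.
Proof.
suff /andP[] : (0 < fib n)%N && (0 < fib n.+1)%N by [].
by elim: n => //= n /andP[h1 h2]; rewrite h2 (_ : fib n.+2 = fib n.+1 + fib n)%N// addn_gt0 h2.
Qed.

Lemma fibR_neq0 {R : realType} n : (fib n)%:R != 0 :> R.
Proof. by rewrite pnatr_eq0 -lt0n fib_gt0. Qed.

(** Column [k] of the inverse of the triangle [Fhat], that is, the preimage of the unit vector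
    e_k. *)
Definition Fhat_basis {R : realType} (k j : nat) : R :=
  if (k <= j)%N then (fib j.+1)%:R ^+ 2 / ((fib k)%:R * (fib k.+1)%:R) else 0.

Lemma Fhat_basisE {R : realType} k :
  Fhat (@Fhat_basis R k) = (fun n => (n == k)%:R : R).
Proof.
apply/funext => -[|n]; rewrite /Fhat /Fhat_basis.
  rewrite leqn0 (eq_sym _ k); case: eqP => [->|_] /=; last by rewrite mulr0.
  by rewrite /fib expr1n !(mulr1, divr1).
have f0 := @fibR_neq0 R n; have f1 := @fibR_neq0 R n.+1.
have f2 := @fibR_neq0 R n.+2; have fk := @fibR_neq0 R k; have fk1 := @fibR_neq0 R k.+1.
rewrite leq_eqVlt ltnS eq_sym.
case: eqP => [<-|_] /=; first by rewrite ltnn; field; rewrite f1 f2.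
by case: leqP => _; [field; rewrite f1 f2 fk fk1|rewrite !mulr0 subrr].
Qed.

(** Dividing y_n by f_n f_{n+1} gives x_n / f_{n+1}^2 - x_{n-1} / f_n^2, so the sum telescopes. *)
Lemma Fhat_inv {R : realType} (x : nat -> R) n :
  x n = (fib n.+1)%:R ^+ 2 *
    \sum_(0 <= k < n.+1) Fhat x k / ((fib k)%:R * (fib k.+1)%:R).
Proof.
elim: n => [|n IH]; first by rewrite big_nat1 /= (_ : fib 0 = 1%N)// (_ : fib 1 = 1%N)// !(mulr1, divr1) mul1r expr1n mul1r.
rewrite big_nat_recr//=; move: IH.
set S := \sum_(0 <= k < n.+1) _ => IH.
have f1 := @fibR_neq0 R n.+1; have f2 := @fibR_neq0 R n.+2.
rewrite mulrDr -[in LHS](mulr1 (x _)).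
set F1 := (fib n.+1)%:R in f1 *; set F2 := (fib n.+2)%:R in f2 *.
rewrite [in RHS]IH -/F1; field. by rewrite f1 f2.
Qed.

Definition wsum {R : realType} (a : nat -> R) (N : nat) : R :=
  \sum_(0 <= j < N) (fib j.+1)%:R ^+ 2 * a j.

Lemma series_Fhat {R : realType} (a x : nat -> R) N :
  series (fun k => a k * x k) N =
  \sum_(0 <= k < N) Fhat x k *
     ((wsum a N - wsum a k) / ((fib k)%:R * (fib k.+1)%:R)).
Proof.
rewrite /series/=; elim: N => [|N IH]; first by rewrite !big_geq.
rewrite [LHS]big_nat_recr//= IH.
(* The added term [k = N] vanishes; both sums then have the range used by [Fhat_inv] at [N]. *)
have -> : \sum_(0 <= k < N) Fhat x k * ((wsum a N - wsum a k) / ((fib k)%:R * (fib k.+1)%:R)) =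
  \sum_(0 <= k < N.+1) Fhat x k * ((wsum a N - wsum a k) / ((fib k)%:R * (fib k.+1)%:R)).
  by rewrite [RHS]big_nat_recr//= subrr mul0r mulr0 addr0.
rewrite (Fhat_inv x N) mulrA mulr_sumr -big_split/=; apply: eq_bigr => k _.
rewrite [wsum a N.+1]/wsum big_nat_recr//= -/(wsum a N); field.
by rewrite !fibR_neq0.
Qed.

(** * A single row of [abar A] *)

Section row.
Context {R : realType} (A : nat -> nat -> R) (n : nat)
  (A0 : cvgn (series (fun k => A n k * Fhat_basis 0 k))).

Let cvg_wsum : cvgn (wsum (A n)).
Proof.
(* Since f_0 f_1 = 1, the entries of [Fhat_basis 0] are exactly the weights f_{j+1}^2. *)
rewrite (_ : wsum _ = series (fun k => A n k * Fhat_basis 0 k))//.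
apply/funext => N; apply: eq_bigr => k _.
by rewrite /Fhat_basis (_ : fib 0 = 1%N)// (_ : fib 1 = 1%N)// mulr1 divr1 mulrC.
Qed.

Lemma abarE k :
  abar A n k = (limn (wsum (A n)) - wsum (A n) k) / ((fib k)%:R * (fib k.+1)%:R).
Proof.
apply/cvg_lim => //.
have : (fun N => (wsum (A n) N - wsum (A n) k) / ((fib k)%:R * (fib k.+1)%:R)) @ \oo
    --> (limn (wsum (A n)) - wsum (A n) k) / ((fib k)%:R * (fib k.+1)%:R).
  by apply: cvgMr_tmp; apply: cvgB; [exact: cvg_wsum|exact: cvg_cst].
apply: cvg_trans; apply: near_eq_cvg; near=> N.
have kN : (k <= N)%N by near: N; exists k.
rewrite /wsum (big_cat_nat _ kN)//= addrAC subrr add0r big_distrl/=.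
by apply: eq_bigr => j _; rewrite mulrAC.
Unshelve. all: by end_near. Qed.

(** In [abarE] the numerator is bounded, since [wsum (A n)] converges, and the denominator is at
    least 1. *)
Lemma abar_bounded : exists B, forall k, `|abar A n k| <= B.
Proof.
(* Only numbers strictly above [M] are known to be bounds, hence the [+ 1]. *)
have [M [_ /(_ (`|M| + 1))]] := cvg_seq_bounded cvg_wsum.
rewrite (le_lt_trans (ler_norm _)) ?ltrDl// => /(_ isT) H.
exists (`|limn (wsum (A n))| + (`|M| + 1)) => k; rewrite abarE.
have k1 : 1 <= (fib k)%:R * (fib k.+1)%:R :> R by rewrite -natrM ler1n muln_gt0 !fib_gt0.
rewrite normrM normfV (ger0_norm (le_trans ler01 k1)) ler_pdivrMr ?(lt_le_trans ltr01)//.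
rewrite -[leLHS]mulr1 ler_pM//.
by apply: le_trans (ler_normB _ _) _; rewrite lerD2l; exact: H.
Qed.

(** By [series_Fhat] and [abarE], the two partial sums differ by (lim w - w_N) times the sum of y_k
    / (f_k f_{k+1}) over k < N, where w is [wsum (A n)]. The second factor is at most [M] in
    absolute value and the first tends to 0. *)
Lemma cvg_abar (x : nat -> R) (M : R) :
  (forall N, \sum_(0 <= k < N) `|Fhat x k| <= M) ->
  cvgn (series (fun k => A n k * x k)) ->
  (fun N => \sum_(0 <= k < N) abar A n k * Fhat x k) @ \oo --> mxop A x n.
Proof.
move=> xM cx.
have D : (fun N => \sum_(0 <= k < N) abar A n k * Fhat x k - series (fun k => A n k * x k) N) @ \oo --> (0 : R).
  apply/norm_cvg0P.
  have : (fun N => `|limn (wsum (A n)) - wsum (A n) N| * M) @ \oo --> (0 : R).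
    rewrite -(mul0r M); apply: cvgMr_tmp; apply/norm_cvg0P.
    rewrite -(subrr (limn (wsum (A n)))); apply: cvgB; [exact: cvg_cst|exact: cvg_wsum].
  apply: (squeeze_cvgr _ (cvg_cst 0)); near=> N; rewrite normr_ge0/=.
  rewrite series_Fhat -sumrB.
  rewrite (eq_bigr (fun k => (limn (wsum (A n)) - wsum (A n) N) * (Fhat x k / ((fib k)%:R * (fib k.+1)%:R)))); last first.
    by move=> k _; rewrite abarE; ring.
  rewrite -mulr_sumr normrM ler_wpM2l//; apply: le_trans (xM N).
  apply: le_trans (ler_norm_sum _ _ _) _; apply: ler_sum => k _.
  have k1 : 1 <= (fib k)%:R * (fib k.+1)%:R :> R by rewrite -natrM ler1n muln_gt0 !fib_gt0.
  rewrite normrM normfV (ger0_norm (le_trans ler01 k1)) ler_pdivrMr ?(lt_le_trans ltr01)//.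
  by rewrite ler_peMr.
rewrite -[mxop A x n]add0r; apply: cvg_trans (cvgD D cx); apply: near_eq_cvg.
by near=> N; rewrite /= subrK.
Unshelve. all: by end_near. Qed.

End row.

(** * Continuity of powers, the unit sphere of [l1Fhat], and finite nets of boxes *)

Lemma normr_powR_continuous {R : realType} (p : R) : 0 < p ->
  continuous (fun x : R => `|x| `^ p).
Proof.
move=> p0 x; have [->|x0] := eqVneq x 0.
  rewrite /continuous_at normr0 powR0 ?gt_eqF//; apply/cvgr0Pnorm_le => e e0.
  near=> y; rewrite ger0_norm ?powR_ge0//.
  have -> : e = (e `^ p^-1) `^ p by rewrite -powRrM mulVf ?gt_eqF// powRr1// ltW.
  apply: ge0_ler_powR; rewrite ?nnegrE ?powR_ge0//; first exact: ltW.
  by near: y; apply: (@nbhs0_le R R); exact: powR_gt0.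
have E (y : R) : y != 0 -> `|y| `^ p = expR (p * ln `|y|).
  by move=> y0; rewrite /powR normr_eq0 (negbTE y0).
rewrite /continuous_at E//.
apply: (@cvg_trans _ ((fun y : R => expR (p * ln `|y|)) @ x)).
  apply: near_eq_cvg; near=> y; rewrite E//; near: y.
  exact: (open_nbhs_nbhs (conj (@open_neq R 0) x0)).
apply: (cvg_comp _ expR); last exact: continuous_expR.
apply: cvgMl_tmp; apply: (cvg_comp _ (@ln R)); first exact: (@norm_continuous _ R).
by apply: continuous_ln; rewrite normr_gt0.
Unshelve. all: by end_near. Qed.

Lemma tail_norm_fin_num {R : realType} {p K : R} {m} {z : nat -> R} :
  (tail_norm p m z <= K%:E)%E -> tail_norm p m z \is a fin_num.
Proof. by move=> zK; rewrite ge0_fin_numE ?tail_norm_ge0// (le_lt_trans zK) ?ltry. Qed.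

Lemma l1Fhat_sum_le {R : realType} (x : nat -> R) (M : R) :
  carrier (l1Fhat R) x -> snorm (l1Fhat R) x <= M ->
  forall N, \sum_(0 <= k < N) `|Fhat x k| <= M.
Proof.
move=> /(lp_carrierE _ ltr01) xl1 xM N; apply: le_trans xM.
rewrite [leRHS](lp_snormE _ ltr01).
set K := fine _; have K0 : 0 <= K by rewrite fine_ge0// tail_norm_ge0.
have : (tail_norm 1 0 (Fhat x) <= K%:E)%E by rewrite fineK// ge0_fin_numE// tail_norm_ge0.
move=> /(tail_norm_leP ltr01 K0)/(_ N); rewrite powRr1//.
by under eq_bigr do rewrite powRr1//.
Qed.

Lemma Fhat_basis_unit_sphere {R : realType} k :
  unit_sphere (l1Fhat R) (Fhat_basis k).
Proof.
have E N : \sum_(0 <= n < N) `|(n == k)%:R : R| `^ 1 = (k < N)%:R.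
  transitivity (\sum_(0 <= n < N | n == k) (1 : R)).
    rewrite [RHS]big_mkcond; apply: eq_bigr => n _.
    by case: (n == k) => /=; rewrite ?normr1 ?normr0 powRr1.
  by rewrite big_nat1_eq; case: ltnP.
have le1 : (tail_norm 1 0 (fun n => (n == k)%:R : R) <= 1%:E)%E.
  by apply/tail_norm_leP => // N; rewrite powR1 E lern1 leq_b1.
rewrite /unit_sphere/= Fhat_basisE; split.
  by apply/(lp_carrierE _ ltr01); rewrite (le_lt_trans le1) ?ltry.
rewrite [LHS](lp_snormE _ ltr01); apply/eqP; rewrite eq_le; apply/andP; split.
  by rewrite -lee_fin fineK// (tail_norm_fin_num le1).
set K := fine _; have K0 : 0 <= K by rewrite fine_ge0// tail_norm_ge0.
have : (tail_norm 1 0 (fun n => (n == k)%:R) <= K%:E)%E by rewrite fineK// (tail_norm_fin_num le1).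
by move=> /(tail_norm_leP ltr01 K0)/(_ k.+1); rewrite E ltnSn powRr1.
Qed.

(** The net is the grid of step [d] starting at [-B]; rounding each coordinate down to the grid
    costs at most [d]. *)
Lemma finite_box_net {R : realType} (m : nat) (B d : R) : 0 < d ->
  exists (N : nat) (c : 'I_N -> nat -> R),
    (forall i n, (m <= n)%N -> c i n = 0) /\
    forall z : nat -> R, (forall n, (n < m)%N -> `|z n| <= B) ->
      exists i, forall n, (n < m)%N -> `|c i n - z n| <= d.
Proof.
(* Coordinates lie in an interval of length [B + B], so their grid indices are below [K]. *)
move=> d0; pose K := (Num.truncn ((B + B) / d)).+1.
pose T := {ffun 'I_m -> 'I_K}.
(* [insub] fails exactly when [m <= n], which makes the centres finitely supported. *)
pose c (g : T) n : R := if insub n is Some i then d * (g i)%:R - B else 0.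
exists #|{: T}|, (fun i => c (enum_val i)); split=> [i n mn|z zB].
  by rewrite /c insubF// ltnNge mn.
have zK (i : 'I_m) : (Num.truncn ((z i + B) / d) < K)%N.
  rewrite ltnS; apply: le_truncn; rewrite ler_pM2r ?invr_gt0// lerD2r.
  exact: le_trans (ler_norm _) (zB _ (ltn_ord i)).
exists (enum_rank [ffun i => Ordinal (zK i)]) => n nm.
rewrite enum_rankK /c insubT ffunE/=.
have zB0 : 0 <= (z n + B) / d.
  apply: divr_ge0 (ltW d0); have := zB n nm; rewrite ler_norml => /andP[h _].
  lra.
have := truncn_itv zB0; set t := (Num.truncn _)%:R.
rewrite -natr1 ler_pdivlMr// ltr_pdivrMr// => /andP[h1 h2].
by rewrite ler_norml; apply/andP; split; lra.
Qed.

(** * The operator L_A: action on the basis, tail estimates, and covers *)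

Section operator.
Context {R : realType} (p : R) (A : nat -> nat -> R) (p1 : 1 <= p)
  (hA : mxclass (l1Fhat R) (lp p) A).

Let p0 : 0 < p. Proof. exact: lt_le_trans p1. Qed.

Let A0 n : cvgn (series (fun k => A n k * Fhat_basis 0 k)).
Proof. by have [/hA[]] := @Fhat_basis_unit_sphere R 0. Qed.

(** With y = e_k, the partial sums in [cvg_abar] are constant once [k < N]. *)
Lemma mxop_Fhat_basis k : mxop A (Fhat_basis k) = (abar A)^~ k.
Proof.
apply/funext => n; have [bX /eqP] := @Fhat_basis_unit_sphere R k.
rewrite eq_le => /andP[/(l1Fhat_sum_le _ _ bX) b1 _].
have [/(_ n) cb _] := hA _ bX.
have := cvg_abar A n (A0 n) _ _ b1 cb; rewrite Fhat_basisE => /cvg_lim <-//.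
apply/cvg_lim => //; apply: cvg_near_cst; near=> N.
have kN : (k < N)%N by near: N; exists k.+1.
transitivity (\sum_(0 <= j < N | j == k) abar A n j).
  rewrite [RHS]big_mkcond; apply: eq_bigr => j _.
  by case: (j == k); rewrite ?mulr1 ?mulr0.
by rewrite big_nat1_eq/= kN.
Unshelve. all: by end_near. Qed.

Lemma mxop_coord_le (x : nat -> R) (M B : R) n : carrier (l1Fhat R) x ->
  snorm (l1Fhat R) x <= M -> (forall k, `|abar A n k| <= B) -> `|mxop A x n| <= B * M.
Proof.
move=> xX xM AB; have xM' := l1Fhat_sum_le _ _ xX xM.
have [/(_ n) cx _] := hA _ xX.
apply: (cvgr_to_le (cvg_norm (cvg_abar A n (A0 n) _ _ xM' cx))).
near=> N; apply: le_trans (ler_norm_sum _ _ _) _.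
apply: le_trans (_ : \sum_(0 <= k < N) B * `|Fhat x k| <= _).
  by apply: ler_sum => k _; rewrite normrM ler_wpM2r.
by rewrite -mulr_sumr ler_wpM2l// (le_trans _ (AB 0%N)).
Unshelve. all: by end_near. Qed.

(** Minkowski bounds the tail of each finite combination of columns of [abar A]; the bound then
    passes to the limit in [N]. *)
Lemma mxop_tail_le (x : nat -> R) (M u : R) m : carrier (l1Fhat R) x ->
  snorm (l1Fhat R) x <= M ->
  (forall k, (tail_norm p m ((abar A)^~ k) <= u%:E)%E) ->
  (tail_norm p m (mxop A x) <= (M * u)%:E)%E.
Proof.
move=> xX xM Au; have xM' := l1Fhat_sum_le _ _ xX xM.
have M0 : 0 <= M by have := xM' 0%N; rewrite big_geq.
have u0 : 0 <= u by rewrite -lee_fin (le_trans _ (Au 0%N))// tail_norm_ge0.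
have H N : (tail_norm p m (fun n => (\sum_(0 <= k < N) abar A n k * Fhat x k)%R) <=
    ((\sum_(0 <= k < N) `|Fhat x k|) * u)%:E)%E.
  elim: N => [|N IH].
    rewrite big_geq// mul0r; apply/tail_norm_leP => // P.
    by rewrite powR0 ?gt_eqF// big1// => n _; rewrite big_geq// normr0 powR0// gt_eqF.
  rewrite big_nat_recr//= mulrDl EFinD.
  have -> : (fun n => \sum_(0 <= k < N.+1) abar A n k * Fhat x k) =
     (fun n => \sum_(0 <= k < N) abar A n k * Fhat x k + Fhat x N * abar A n N).
    by apply/funext => n; rewrite big_nat_recr//= [abar A n N * _]mulrC.
  apply: le_trans (tail_normD _ _ _ _ p1) _; apply: leeD IH _.
  exact: tail_norm_scale_le.
apply/tail_norm_leP => //; first exact: mulr_ge0.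
(* With [P] fixed only finitely many coordinates occur, so coordinatewise convergence suffices. *)
move=> P; have C : (fun N => \sum_(m <= n < P) `|\sum_(0 <= k < N) abar A n k * Fhat x k| `^ p) @ \oo -->
    \sum_(m <= n < P) `|mxop A x n| `^ p.
  apply: cvg_big => [|n _]; first exact: add_continuous.
  apply: (cvg_comp _ (fun y : R => `|y| `^ p)); last exact: normr_powR_continuous.
  by have [/(_ n) cx _] := hA _ xX; exact: cvg_abar xM' cx.
apply: (cvgr_to_le C); near=> N.
have K0 : 0 <= (\sum_(0 <= k < N) `|Fhat x k|) * u by rewrite mulr_ge0// sumr_ge0.
apply: le_trans (_ : ((\sum_(0 <= k < N) `|Fhat x k|) * u) `^ p <= _).
  exact: (tail_norm_leP p0 K0).1.
by apply: (ge0_ler_powR (ltW p0)); rewrite ?nnegrE// ?ler_wpM2r// mulr_ge0.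
Unshelve. all: by end_near. Qed.

(** The p-th power of the distance to a centre splits at [m]. The tail uses up (M u)^p, and the gap
    to e^p is the room left for approximating the first [m] coordinates. *)
Lemma mxop_image_finite_net (Q : set (nat -> R)) (M u e : R) m :
  (forall x, Q x -> carrier (l1Fhat R) x /\ snorm (l1Fhat R) x <= M) ->
  0 <= M -> (forall k, (tail_norm p m ((abar A)^~ k) <= u%:E)%E) -> M * u < e ->
  exists (N : nat) (c : 'I_N -> nat -> R), (forall i, carrier (lp p) (c i)) /\
    mxop A @` Q `<=` \bigcup_i mball (lp p) (sdist (lp p)) (c i) e.
Proof.
move=> QM M0 Au Mue.
have u0 : 0 <= u by rewrite -lee_fin (le_trans _ (Au 0%N))// tail_norm_ge0.
have Mu0 : 0 <= M * u by exact: mulr_ge0.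
have e0 : 0 < e by exact: le_lt_trans Mue.
have : (M * u) `^ p < e `^ p by apply: (gt0_ltr_powR p0); rewrite ?nnegrE// ltW.
rewrite -subr_gt0; set E := e `^ p - _ => E0.
(* Chosen so that [m] errors of size [d] cost at most half of the gap [E]; [m.+1] avoids dividing by
   0. *)
pose d := (E / (2 * m.+1%:R)) `^ p^-1.
have d0 : 0 < d by rewrite powR_gt0// divr_gt0// mulr_gt0// ltr0n.
have dE : m%:R * d `^ p <= E / 2.
  rewrite -powRrM mulVf ?gt_eqF// powRr1; last by rewrite divr_ge0 ?ltW// mulr_ge0.
  have -> : m%:R * (E / (2 * m.+1%:R)) = E / 2 * (m%:R / m.+1%:R) by rewrite invfM; ring.
  apply: ler_piMr; first by rewrite divr_ge0 ?ltW.
  by rewrite ler_pdivrMr ?ltr0n// mul1r ler_nat.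
have /choice[B hB] := fun n => abar_bounded A n (A0 n).
have B0 n : 0 <= B n by rewrite (le_trans _ (hB n 0%N)).
(* The sum serves as one bound for all [m] coordinates, each being at most [B n * M]. *)
have [N [c [c0 cnet]]] := finite_box_net m (\sum_(0 <= n < m) B n * M) _ d0.
(* The distance actually achieved; it is below [e] because half of the gap remains. *)
pose K := (E / 2 + (M * u) `^ p) `^ p^-1.
have EMu0 : 0 <= E / 2 + (M * u) `^ p by rewrite addr_ge0 ?powR_ge0// divr_ge0 ?ltW.
have K0 : 0 <= K by exact: powR_ge0.
have Kp : K `^ p = E / 2 + (M * u) `^ p by rewrite -powRrM mulVf ?gt_eqF// powRr1.
have Ke : K < e.
  rewrite ltNge; apply/negP => /(ge0_ler_powR (ltW p0)).
  rewrite !nnegrE Kp => /(_ (ltW e0) K0); apply/negP; rewrite -ltNge; move: E0; rewrite /E; lra.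
exists N, c; split=> [i|_ [x Qx <-]].
  apply/(lp_carrierE _ p0); apply: le_lt_trans (ltry ((\sum_(0 <= n < m) `|c i n| `^ p) `^ p^-1)).
  apply/(tail_norm_leP p0 (powR_ge0 _ _)) => P.
  rewrite -powRrM mulVf ?gt_eqF// powRr1; last by apply: sumr_ge0 => n _; exact: powR_ge0.
  have [Pm|/ltnW mP] := leqP P m.
    rewrite [leRHS](big_cat_nat _ Pm)//= lerDl.
    by apply: sumr_ge0 => n _; exact: powR_ge0.
  rewrite (big_cat_nat _ mP)//= gerDl [leLHS]big_nat big1// => n /andP[mn _].
  by rewrite c0// normr0 powR0// gt_eqF.
have [xX xM] := QM x Qx.
have [n nm|i ci] := cnet (mxop A x).
  apply: le_trans (mxop_coord_le _ _ _ n xX xM (hB n)) _.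
  rewrite (big_cat_nat (n := n) _ (ltnW nm))//= (big_ltn nm) addrCA lerDl.
  by rewrite addr_ge0// sumr_ge0// => j _; exact: mulr_ge0.
have Ax := mxop_tail_le _ _ _ _ xX xM Au.
exists i => //; split; first by have [] := hA _ xX.
have : (tail_norm p 0 (fun n => (c i n - mxop A x n)%R) <= K%:E)%E.
  apply/tail_norm_leP => // P; rewrite Kp.
  (* Enlarging the range past [m] allows the split there even when [P < m]. *)
  apply: le_trans (_ : \sum_(0 <= n < maxn m P) `|c i n - mxop A x n| `^ p <= _).
    rewrite [leRHS](big_cat_nat _ (leq_maxr m P))//= lerDl.
    by apply: sumr_ge0 => n _; exact: powR_ge0.
  rewrite (big_cat_nat _ (leq_maxl m P))//=; apply: lerD.
    apply: le_trans dE; rewrite mulr_natl -[m in leRHS]subn0 -sumr_const_nat.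
    apply: ler_sum_nat => n /andP[_ nm].
    by apply: (ge0_ler_powR (ltW p0)); rewrite ?nnegrE ?ci// ltW.
  rewrite big_nat_cond (eq_bigr (fun n => `|mxop A x n| `^ p)); last first.
    by move=> n /andP[/andP[mn _] _]; rewrite c0// sub0r normrN.
  by rewrite -big_nat_cond; exact: (tail_norm_leP p0 Mu0).1.
move=> cK; rewrite /sdist lp_snormE// (le_lt_trans _ Ke)//.
by rewrite -lee_fin fineK// (tail_norm_fin_num cK).
Qed.

(** Each column of [abar A] lies within [e] of some centre, so its tail exceeds that of the centre
    by at most [e]. Stated with [<=], it serves both the lower bound on the measure and the
    compactness criterion. *)
Lemma abar_tail_le_cover (N : nat) (c : 'I_N -> nat -> R) (e : R) :
  (forall i, carrier (lp p) (c i)) ->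
  mxop A @` unit_sphere (l1Fhat R) `<=`
    [set y | exists2 i, carrier (lp p) y & sdist (lp p) (c i) y <= e] ->
  (ereal_inf (range (fun m => ereal_sup (range (fun k =>
     tail_norm p m ((abar A)^~ k))))) <= e%:E)%E.
Proof.
move=> clp cov; apply/lee_addgt0Pr => h h0.
(* Finiteness of the cover gives one [m] for all centres. *)
have : \forall m \near \oo, forall i, (tail_norm p m (c i) <= h%:E)%E.
  apply: filter_forall => i.
  by apply: tail_norm_small => //; exact/lp_carrierE.
case=> m _ /(_ m (leqnn m)) /= ch.
apply: (@le_trans _ _ (ereal_sup (range (fun k => tail_norm p m ((abar A)^~ k))))).
  by apply: ereal_inf_lbound; exists m.
apply: ge_ereal_sup => _ [k _ <-].
have bS := @Fhat_basis_unit_sphere R k.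
have [i zlp ze] := cov _ (imageP _ bS).
rewrite mxop_Fhat_basis in zlp ze; set z := (abar A)^~ k in zlp ze *.
have cz : (tail_norm p 0 (fun n => (c i n - z n)%R) <= e%:E)%E.
  move: ze; rewrite /sdist lp_snormE// -lee_fin fineK// ge0_fin_numE ?tail_norm_ge0//.
  apply: le_lt_trans (tail_normD _ _ _ _ p1) _; rewrite tail_normN.
  by apply: lte_add_pinfty; exact/lp_carrierE.
have -> : z = fun n => c i n + - (c i n - z n) by apply/funext => n; ring.
apply: le_trans (tail_normD _ _ _ _ p1) _.
rewrite tail_normN addeC leeD//.
by apply: le_trans cz; exact: tail_norm_nonincreasing.
Qed.

End operator.

(** * The formula for the measure of noncompactness and the compactness criterion *)

Theorem theorem3p8 (R : realType) (p : R) (hp : 1 <= p)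
    (A : nat -> nat -> R) (hA : mxclass (l1Fhat R) (lp p) A) :
  ((fun m : nat => ereal_sup (range (fun k : nat =>
      ((\sum_(m <= n <oo) (`|abar A n k| `^ p)%:E) `^ p^-1)%E))) @ \oo
    --> op_mnc (l1Fhat R) (lp p) (mxop A)) /\
  (compact_op (l1Fhat R) (lp p) (mxop A) <->
   (fun m : nat => ereal_sup (range (fun k : nat =>
      ((\sum_(m <= n <oo) (`|abar A n k| `^ p)%:E) `^ p^-1)%E))) @ \oo
    --> (0%E : \bar R)).
Proof.
have p0 : 0 < p by exact: lt_le_trans hp.
pose u m := ereal_sup (range (fun k => tail_norm p m ((abar A)^~ k))).
rewrite -/u; set l := ereal_inf (range u).
(* Tails shrink as [m] grows, so the limit exists in [\bar R] and equals the infimum. *)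
have ul : u @ \oo --> l.
  apply: ereal_nonincreasing_cvgn => m n mn; apply: ge_ereal_sup => _ [k _ <-].
  apply: le_trans (tail_norm_nonincreasing _ p0 mn) _.
  by apply: ereal_sup_ubound; exists k.
have l0 : (0 <= l)%E.
  apply: le_ereal_inf_tmp => _ [m _ <-].
  by apply: le_trans (tail_norm_ge0 p m ((abar A)^~ 0%N)) _; apply: ereal_sup_ubound; exists 0%N.
have u_lt (e : R) : (l < e%:E)%E -> exists m, forall k, (tail_norm p m ((abar A)^~ k) <= e%:E)%E.
  move=> /ereal_inf_lt[_ [m _ <-]] /ltW ume; exists m => k.
  by apply: le_trans ume; apply: ereal_sup_ubound; exists k.
split.
  suff -> : op_mnc (l1Fhat R) (lp p) (mxop A) = l by [].
  apply/eqP; rewrite eq_le; apply/andP; split; last first.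
    apply: le_ereal_inf_tmp => _ [e [e0 [N [c [r [cr cov]]]]] <-].
    apply: (abar_tail_le_cover p A hp hA N c) => [i|y /cov [i _ [ylp yr]]].
      by have [] := cr i.
    exists i => //; rewrite (le_trans (ltW yr))// ltW//.
    by have [_ /andP[]] := cr i.
  have [->|loo] := eqVneq l +oo%E; first exact: leey.
  have lfin : l \is a fin_num by rewrite ge0_fin_numE// ltey.
  rewrite -(fineK lfin); apply/lee_addgt0Pr => h h0.
  (* The values h/3, h/2 and h keep strict both the gap between tail bound and radius and the one
     between radius and [fine l + h]. *)
  have [|m um] := u_lt (fine l + h / 3).
    by rewrite -[ltLHS](fineK lfin) lte_fin ltrDl divr_gt0.
  have fl0 : 0 <= fine l by exact: fine_ge0.
  have [||N [c [clp cov]]] := mxop_image_finite_net p A hp hA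
      (unit_sphere (l1Fhat R)) 1 _ (fine l + h / 2) m _ ler01 um.
  - by move=> x [xX ->].
  - by rewrite mul1r; lra.
  apply: ereal_inf_lbound; exists (fine l + h) => //=; split; first by lra.
  exists N, c, (fun=> fine l + h / 2); split=> // i; split; first exact: clp.
  by apply/andP; split; lra.
split=> [cA|/(cvg_unique _ ul) l00 Q [QX [M QM]] e e0].
  suff : l = 0%E by move=> <-.
  apply/eqP; rewrite eq_le l0 andbT; apply/lee_addgt0Pr => e e0; rewrite add0e.
  have [|N [c [clp cov]]] := cA (unit_sphere (l1Fhat R)) _ e e0.
    by split=> [x []//|]; exists 1 => x [_ ->].
  apply: (abar_tail_le_cover p A hp hA N c) => // y /cov [i _ [ylp yr]].
  by exists i => //; exact: ltW.
(* [M] may be zero or negative; this larger bound can be divided by, and the tail of the image then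
   has norm at most e/2. *)
have M1 : 0 < `|M| + 1 by rewrite ltr_wpDl.
have [|m um] := u_lt (e / 2 / (`|M| + 1)); first by rewrite l00// lte_fin !divr_gt0.
apply: (mxop_image_finite_net p A hp hA Q (`|M| + 1) _ e m _ (ltW M1) um).
  move=> x Qx; split; first exact: QX.
  by apply: le_trans (QM x Qx) _; apply: le_trans (ler_norm _) _; rewrite lerDl.
by rewrite mulrC divfK ?gt_eqF//; lra.
Qed.
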